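(* Let $r\ge 2$ and $m\ge 1$ be integers, let $\mathbf{a}\in\mathbb{R}^{r-1}$, and let $b,c>0$. For $\boldsymbol{\psi}\in\mathbb{R}^{r-1}$ and $\nu\in\mathbb{R}$ put $$G(\boldsymbol{\psi},\nu)=\sum_{\mathbf{j}\in D}\frac{e^{\boldsymbol{\psi}\cdot\mathbf{j}^*}}{(j_1!j_2!\cdots j_r!)^\nu},$$ and consider the family $$h^*_{\mathbf{a},b,c}(\boldsymbol{\psi},\nu)=g(\boldsymbol{\psi},\nu)\,e^{\boldsymbol{\psi}\cdot\mathbf{a}-b\nu}\,G(\boldsymbol{\psi},\nu)^{-c}\,K(\mathbf{a},b,c),$$ where $K(\mathbf{a},b,c)^{-1}=\int_{\mathbb{R}^{r-1}}\int_{\mathbb{R}} g(\boldsymbol{\psi},\nu)\,e^{\boldsymbol{\psi}\cdot\mathbf{a}-b\nu}\,G(\boldsymbol{\psi},\nu)^{-c}\,d\nu\,d\boldsymbol{\psi}$. If $g$ is the density of a (nondegenerate) normal distribution on $\mathbb{R}^r$, then $K(\mathbf{a},b,c)^{-1}<\infty$. In this case, if $(\boldsymbol{\psi},\nu)$ has prior density $h^*_{\mathbf{a},b,c}$ and, conditionally on $(\boldsymbol{\psi},\nu)$, an observation $\mathbf{k}\in D$ is drawn from the Conway-Maxwell-Multivariate distribution with parameters $(\boldsymbol{\psi},\nu)$, then the posterior density of $(\boldsymbol{\psi},\nu)$ given $\mathbf{k}$ is $h^*_{\mathbf{a}',b',c'}$ with $$\mathbf{a}'=\mathbf{a}+\mathbf{k}^*,\qquad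 b'=b+\log(k_1!k_2!\cdots k_r!),\qquad c'=c+1 .$$
   Context: $D$ is the set of integer vectors $\mathbf{j}=(j_1,\dots,j_r)$ with $j_i\ge 0$ and $\sum_{i=1}^r j_i=m$; for $\mathbf{j}\in D$, $\mathbf{j}^*=(j_1,\dots,j_{r-1})$. The Conway-Maxwell-Multivariate (COMM) distribution with parameters $\mathbf{p}=(p_1,\dots,p_r)$ ($p_i>0$, $\sum_i p_i=1$) and $\nu\in\mathbb{R}$ has mass function on $D$ proportional in $\mathbf{k}$ to $\left(\frac{m!}{k_1!\cdots k_r!}\right)^\nu\prod_{i=1}^r p_i^{k_i}$. With $\boldsymbol{\psi}=(\log(p_1/p_r),\dots,\log(p_{r-1}/p_r))$, this mass function is $$P(\mathbf{k}\mid\boldsymbol{\psi},\nu)=\frac{e^{\boldsymbol{\psi}\cdot\mathbf{k}^*}}{(k_1!\cdots k_r!)^\nu}\Big/G(\boldsymbol{\psi},\nu),\qquad \mathbf{k}\in D.$$ *)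

(* Defs.v *)
From HB Require Import structures.
From mathcomp Require Import all_boot all_order all_algebra.
From mathcomp Require Import all_classical all_reals all_analysis.

Set Implicit Arguments.
Unset Strict Implicit.
Unset Printing Implicit Defensive.
Import Order.TTheory GRing.Theory Num.Theory.
Import numFieldNormedType.Exports.
Local Open Scope classical_set_scope.
Local Open Scope ring_scope.

(* R^n, with the sigma-algebra generated by the coordinate projections. *)
Notation Rn R n := (n.-tuple (measurableTypeR R)).

Section lebesgue_cons.
Context {R : realType} (n : nat) (mu : {sigma_finite_measure set (Rn R n) -> \bar R}).

(* One more coordinate: the image of lebesgue_measure \x mu under (x, t) |-> x :: t. *)
Definition tuple_cons (z : measurableTypeR R * Rn R n) : Rn R n.+1 :=
  [the n.+1.-tuple _ of z.1 :: z.2].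

Lemma measurable_tuple_cons : measurable_fun [set: _] tuple_cons.
Proof. exact: measurable_cons. Qed.

Definition lebesgue_cons : set (Rn R n.+1) -> \bar R :=
  pushforward (@lebesgue_measure R \x mu)%E tuple_cons.

Let lebesgue_cons0 : lebesgue_cons set0 = 0%E.
Proof. by rewrite /lebesgue_cons /pushforward preimage_set0 measure0. Qed.

Let lebesgue_cons_ge0 A : (0 <= lebesgue_cons A)%E.
Proof. by rewrite /lebesgue_cons /pushforward; apply: measure_ge0. Qed.

Let lebesgue_cons_sigma_additive : semi_sigma_additive lebesgue_cons.
Proof.
move=> F mF tF mUF; rewrite /lebesgue_cons /pushforward preimage_bigcup.
have mpre A : measurable A -> measurable (tuple_cons @^-1` A).
  by move=> mA; rewrite -[X in measurable X]setTI; exact: measurable_tuple_cons.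
apply: measure_semi_sigma_additive.
- by move=> k; exact: mpre.
- apply/trivIsetP => /= i j _ _ ij; rewrite -preimage_setI.
  by move/trivIsetP : tF => /(_ _ _ _ _ ij) ->//; rewrite preimage_set0.
- by rewrite -preimage_bigcup; exact: mpre.
Qed.

HB.instance Definition _ := isMeasure.Build _ _ _ lebesgue_cons
  lebesgue_cons0 lebesgue_cons_ge0 lebesgue_cons_sigma_additive.

Let lebesgue_cons_sigma_finite : sigma_finite setT lebesgue_cons.
Proof.
have /sigma_finiteP[F [TF ndF Foo]] := sigma_finiteT (@lebesgue_measure R).
have /sigma_finiteP[G [TG ndG Goo]] := sigma_finiteT mu.
pose split (x : Rn R n.+1) : measurableTypeR R * Rn R n :=
  (tnth x ord0, [tuple of behead x]).
have splitK z : split (tuple_cons z) = z.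
  by case: z => x t; congr pair; apply/val_inj.
have msplit : measurable_fun [set: _] split.
  apply: measurable_fun_pair; first exact: measurable_tnth.
  exact: measurable_behead.
exists (fun k => split @^-1` (F k `*` G k)).
  apply/esym; rewrite -subTset => x _; set z := split x.
  have [i _ Fi] : (\bigcup_i F i) z.1 by rewrite -TF.
  have [j _ Gj] : (\bigcup_j G j) z.2 by rewrite -TG.
  exists (maxn i j) => //; split.
  - by move: (z.1) Fi; exact/subsetPset/ndF/leq_maxl.
  - by move: (z.2) Gj; exact/subsetPset/ndG/leq_maxr.
move=> k; have [mF Foo_k] := Foo k; have [mG Goo_k] := Goo k; split.
  by rewrite -[X in measurable X]setTI; apply: msplit => //; exact: measurableX.
rewrite /lebesgue_cons /pushforward -comp_preimage.
rewrite (_ : split \o tuple_cons = id); last by apply/funext => z /=.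
by rewrite preimage_id product_measure1E// lte_mul_pinfty// ge0_fin_numE.
Qed.

HB.instance Definition _ := Measure_isSigmaFinite.Build _ _ _ lebesgue_cons
  lebesgue_cons_sigma_finite.

End lebesgue_cons.

Fixpoint lebesgue_Rn {R : realType} (n : nat) :
    {sigma_finite_measure set (Rn R n) -> \bar R} :=
  match n with
  | 0 => dirac [tuple]
  | k.+1 => lebesgue_cons (lebesgue_Rn k)
  end.

(* This determines lebesgue_Rn n as the usual n-dimensional Lebesgue measure. *)
Lemma lebesgue_Rn_box (R : realType) n (A : 'I_n -> set (measurableTypeR R)) :
  (forall i, measurable (A i)) ->
  lebesgue_Rn n [set x | forall i, A i (tnth x i)] =
  (\prod_(i < n) lebesgue_measure (A i))%E.
Proof.
elim: n A => [|n IH] A mA.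
  rewrite big_ord0 /= diracE (_ : _ \in _)//.
  by apply/mem_set => -[].
rewrite big_ord_recl -(IH (fun i => A (lift ord0 i)))//.
have mbox : measurable [set x : Rn R n | forall i, A (lift ord0 i) (tnth x i)].
  rewrite (_ : mkset _ = \bigcap_(i in [set: 'I_n])
      ((@tnth _ (measurableTypeR R))^~ i @^-1` A (lift ord0 i))); last first.
    by apply/seteqP; split=> x /= xA i => [_|]; exact: xA.
  apply: fin_bigcap_measurable => [|i _]; first exact: finite_finset.
  by rewrite -[X in measurable X]setTI; exact: measurable_tnth.
rewrite -product_measure1E//= /lebesgue_cons /pushforward.
congr (product_measure1 _ _ _); apply/seteqP; split=> -[x t] /=.
- move=> xtA; split; first by have := xtA ord0; rewrite tnth0.
  by move=> i; have := xtA (lift ord0 i); rewrite tnthS.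
- move=> [Ax At] i; have [j ->|->] := unliftP ord0 i; last by rewrite tnth0.
  by rewrite tnthS; exact: At.
Qed.

(* The space of (psi, nu), i.e. R^r for n = r - 1. *)
Notation param R n := (Rn R n * measurableTypeR R)%type.

Definition lebesgue_param {R : realType} (n : nat) : {measure set param R n -> \bar R} :=
  (lebesgue_Rn n \x @lebesgue_measure R)%E.

Section density.
Context d (T : measurableType d) (R : realType).

Definition is_density (lambda : {measure set T -> \bar R}) (P : set T -> \bar R)
    (f : T -> R) : Prop :=
  [/\ measurable_fun [set: T] f,
      forall x, 0 <= f x &
      forall A, measurable A -> P A = (\int[lambda]_(x in A) (f x)%:E)%E].

End density.

Section conditional.
Context d d1 d2 (Omega : measurableType d) (T1 : measurableType d1)
  (T2 : measurableType d2) (R : realType) (P : probability Omega R).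
Variables (X : {RV P >-> T1}) (Y : {RV P >-> T2}).

(* Given X, the (discrete) variable Y has mass function p X. *)
Definition has_conditional_pmf (p : T1 -> T2 -> R) : Prop :=
  forall (A : set T1) (y : T2), measurable A ->
    P (X @^-1` A `&` Y @^-1` [set y]) =
    (\int[distribution P X]_(x in A) (p x y)%:E)%E.

(* The law of X given the event Y = y; junk if that event is negligible, which
   is_posterior_density excludes. *)
Definition conditional_law (y : T2) : set T1 -> \bar R := fun A =>
  (fine (P (X @^-1` A `&` Y @^-1` [set y])) / fine (P (Y @^-1` [set y])))%:E.

Definition is_posterior_density (lambda : {measure set T1 -> \bar R}) (y : T2)
    (f : T1 -> R) : Prop :=
  (0 < P (Y @^-1` [set y]))%E /\ is_density lambda (conditional_law y) f.

End conditional.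

Section normal.
Context {R : realType}.

Definition posdefmx d (S : 'M[R]_d) : Prop :=
  S^T = S /\ forall x : 'rV[R]_d, x != 0 -> 0 < (x *m S *m x^T) 0 0.

Definition mvnormal_pdf d (mu : 'rV[R]_d) (S : 'M[R]_d) (x : 'rV[R]_d) : R :=
  (Num.sqrt ((2 * pi) ^+ d * \det S))^-1 *
  expR (- ((x - mu) *m invmx S *m (x - mu)^T) 0 0 / 2).

Definition row_of_param n (t : param R n) : 'rV[R]_(n + 1) :=
  row_mx (\row_i (tnth t.1 i : R)) (t.2 : R)%:M.

Definition is_normal_density n (g : param R n -> R) : Prop :=
  exists (mu : 'rV[R]_(n + 1)) (S : 'M[R]_(n + 1)),
    posdefmx S /\ forall t, g t = mvnormal_pdf mu S (row_of_param t).

End normal.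

Section COMM.
Context {R : realType} (r m : nat).
Implicit Types (j k : r.-tuple nat) (t : param R r.-1) (a : 'rV[R]_r.-1).

Definition commD : set (r.-tuple nat) := [set j | (\sum_(i < r) tnth j i = m)%N].

Lemma finite_commD : finite_set commD.
Proof.
apply: (@sub_finite_set _ _
  ((fun f : r.-tuple 'I_m.+1 => map_tuple (@nat_of_ord _) f) @` setT)).
  move=> j /= jm; exists (map_tuple inord j) => //.
  apply/eq_from_tnth => i; rewrite !tnth_map inordK// ltnS -jm.
  by rewrite (bigD1 i)//= leq_addr.
exact/finite_image/finite_finset.
Qed.

(* j^*, i.e. j without its last coordinate *)
Definition star j : 'rV[R]_r.-1 :=
  \row_(i < r.-1) (tnth j (widen_ord (leq_pred r) i))%:R.

Definition dot (psi : Rn R r.-1) a : R := \sum_(i < r.-1) (tnth psi i : R) * a 0 i.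

Definition factprod j : R := (\prod_(i < r) (tnth j i)`!)%:R.

Definition comm_weight t j : R :=
  expR (dot t.1 (star j)) / factprod j `^ t.2.

Definition commG t : R := \sum_(j \in commD) comm_weight t j.

(* P(k | psi, nu), extended by 0 outside of commD *)
Definition comm_pmf t k : R := if k \in commD then comm_weight t k / commG t else 0.

Section family.
Variables (g : param R r.-1 -> R) (a : 'rV[R]_r.-1) (b c : R).

Definition kernel_fun t : R := g t * expR (dot t.1 a - b * t.2) * commG t `^ (- c).

(* K(a, b, c)^-1, possibly +oo *)
Definition Kinv : \bar R :=
  (\int[lebesgue_Rn r.-1]_psi \int[lebesgue_measure]_nu (kernel_fun (psi, nu))%:E)%E.

Definition hstar t : R := kernel_fun t * (fine Kinv)^-1.

End family.

End COMM.

(* Main.v *)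
(* G dominates each of its summands, so G^-c is at most the exponential of an
   affine function of (psi, nu); times a normal density this is bounded by a
   product of one-dimensional Gaussians, whose integral is finite.  The posterior
   is then Bayes' formula: the mass function at k times the kernel with parameters
   (a, b, c) is pointwise the kernel with parameters (a', b', c'). *)

Require Import Defs.
From mathcomp Require Import all_boot all_order all_algebra.
From mathcomp Require Import all_classical all_reals all_analysis.
From mathcomp Require Import finmap measurable_realfun ring lra.
Import Order.TTheory GRing.Theory Num.Theory.
Import numFieldNormedType.Exports.
Local Open Scope classical_set_scope.
Local Open Scope ring_scope.

(** * Bounds for positive definite quadratic forms *)

Section quadratic_forms.
Context {R : realType} {d : nat}.
Implicit Types (S : 'M[R]_d) (x : 'rV[R]_d).

(** The form vanishes on the kernel of [S], so positivity leaves only the zero vector there. *)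
Lemma posdefmx_unitmx S : posdefmx S -> S \in unitmx.
Proof.
move=> [_ S_gt0]; rewrite -row_free_unit -kermx_eq0; apply/rowV0P => v.
move=> /sub_kermxP vS0; apply/eqP; apply: contraT => /S_gt0.
by rewrite vS0 mul0mx mxE ltxx.
Qed.

Lemma posdefmx_ge0 S x : posdefmx S -> 0 <= (x *m S *m x^T) 0 0.
Proof.
move=> [_ S_gt0]; have [->|/S_gt0/ltW//] := eqVneq x 0.
by rewrite !mul0mx mxE.
Qed.

Lemma sqnormE x : (x *m x^T) 0 0 = \sum_i x 0 i ^+ 2.
Proof. by rewrite mxE; apply: eq_bigr => i _; rewrite mxE expr2. Qed.

Lemma quadratic_form_le S x :
  (x *m S *m x^T) 0 0 <= (\sum_j \sum_i `|S i j|) * (x *m x^T) 0 0.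
Proof.
have x2_le i : x 0 i ^+ 2 <= (x *m x^T) 0 0.
  by rewrite sqnormE (bigD1 i)//= lerDl sumr_ge0// => j _; exact: sqr_ge0.
set q := (x *m x^T) 0 0 in x2_le *.
rewrite mxE mulr_suml; apply: ler_sum => j _; rewrite !mxE !mulr_suml.
apply: ler_sum => i _; rewrite (le_trans (ler_norm _))// mulrAC !normrM mulrC.
rewrite ler_wpM2l//; have := x2_le i; have := x2_le j.
rewrite -(real_normK (num_real (x 0 i))) -(real_normK (num_real (x 0 j))).
(* Nonnegativity of this square gives |x_i| |x_j| <= (x_i^2 + x_j^2) / 2, hence at most |x|^2. *)
have := sqr_ge0 (`|x 0 i| - `|x 0 j|); rewrite sqrrB; lra.
Qed.

(* Expand the nonnegative form of S at y = x S^-1 - k x, where k is the inverse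
   of an upper bound for S. *)
Lemma posdefmx_invmx_ge S : posdefmx S ->
  exists2 k : R, 0 < k &
    forall x, k * (x *m x^T) 0 0 <= (x *m invmx S *m x^T) 0 0.
Proof.
move=> Spos; have Su := posdefmx_unitmx _ Spos; have [Ssym _] := Spos.
have Sisym : (invmx S)^T = invmx S by rewrite trmx_inv Ssym.
(* The summand 1 keeps [M] positive even when [d] is 0. *)
pose M := 1 + \sum_j \sum_i `|S i j|.
have M_gt0 : 0 < M.
  by rewrite ltr_wpDr// sumr_ge0// => j _; rewrite sumr_ge0.
exists M^-1 => [|x]; first by rewrite invr_gt0.
have := posdefmx_ge0 _ (x *m invmx S - M^-1 *: x) Spos.
have -> : (x *m invmx S - M^-1 *: x) *m S *m (x *m invmx S - M^-1 *: x)^T =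
    x *m invmx S *m x^T - M^-1 *: (x *m x^T) -
    (M^-1 *: (x *m x^T) - M^-1 *: (M^-1 *: (x *m S *m x^T))).
  have -> : (x *m invmx S - M^-1 *: x)^T = invmx S *m x^T - M^-1 *: x^T.
    by rewrite linearB linearZ /= trmx_mul Sisym.
  rewrite mulmxBl mulmxKV// -scalemxAl mulmxBl !mulmxBr -!scalemxAl -!scalemxAr.
  by rewrite !mulmxA mulmxK.
have xSx : (x *m S *m x^T) 0 0 <= M * (x *m x^T) 0 0.
  rewrite (le_trans (quadratic_form_le _ _))// ler_wpM2r//.
    by rewrite sqnormE sumr_ge0// => i _; exact: sqr_ge0.
  by rewrite lerDr.
(* The quadratic term of the expansion thus absorbs only one of the two copies of -M^-1 |x|^2; the
   other one is the desired bound. *)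
have {}xSx : M^-1 ^+ 2 * (x *m S *m x^T) 0 0 <= M^-1 * (x *m x^T) 0 0.
  rewrite (le_trans (ler_wpM2l _ xSx)) ?sqr_ge0// expr2 -!mulrA mulKf//.
  by rewrite gt_eqF.
move: xSx; set xx := x *m x^T; set xSx := x *m S *m x^T.
set xSix := x *m invmx S *m x^T; rewrite !mxE; lra.
Qed.

End quadratic_forms.

(** * One-dimensional Gaussian integrals and integrals of products over R^n *)

Section gaussian_integral.
Context {R : realType}.

(** Completing the square turns the integrand into a constant multiple of a normal density, whose
    integral is 1. *)
Lemma integral_expR_quadratic_lty (l k u : R) : 0 < k ->
  (\int[lebesgue_measure]_x (expR (l * x - k * (x - u) ^+ 2))%:E < +oo)%E.
Proof.
move=> k_gt0; pose s := (Num.sqrt (2 * k))^-1.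
have s_neq0 : s != 0 by rewrite invr_eq0 gt_eqF// sqrtr_gt0 mulr_gt0.
have s2 : s ^+ 2 *+ 2 = k^-1.
  rewrite exprVn sqr_sqrtr ?mulr_ge0 ?ltW// -mulr_natl; field.
  by rewrite gt_eqF.
(* After completing the square, [v] is the mean and [s] the standard deviation (variance 1/(2k));
   [C] collects the leftover constant divided by the peak of the density. *)
pose v := u + l / (2 * k).
pose C := expR (l * u + l ^+ 2 / (4 * k)) / normal_peak s.
have C_ge0 : 0 <= C by rewrite divr_ge0 ?expR_ge0 ?normal_peak_ge0.
have pdfE x : normal_pdf v s x = normal_peak s * normal_fun v s x.
  by rewrite /normal_pdf (negbTE s_neq0).
rewrite (eq_integral (fun x : measurableTypeR R =>
    C%:E * (normal_pdf v s x)%:E)%E); last first.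
  move=> x _; rewrite -EFinM pdfE /C [in RHS]mulrA divfK; last first.
    by rewrite gt_eqF// normal_peak_gt0.
  rewrite /normal_fun s2 -expRD; congr (expR _)%:E; rewrite /v; field.
  by rewrite gt_eqF.
rewrite ge0_integralZl//=.
- by rewrite integral_normal_pdf mule1 ltry.
- by apply/measurable_EFinP; exact: measurable_normal_pdf.
- by move=> x _; rewrite lee_fin normal_pdf_ge0.
Qed.

(** Induction on [n]: [lebesgue_Rn] adds one coordinate at a time, and Tonelli factors out the
    first. For [n = 0] both sides are 1. *)
Lemma integral_lebesgue_Rn_prod (n : nat) (f : 'I_n -> measurableTypeR R -> R) :
  (forall i, measurable_fun [set: measurableTypeR R] (f i)) ->
  (forall i x, 0 <= f i x) ->
  (\int[lebesgue_Rn n]_x (\prod_(i < n) f i (tnth x i))%:E =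
   \prod_(i < n) \int[lebesgue_measure]_x (f i x)%:E)%E.
Proof.
elim: n f => [|n IH] f mf f_ge0.
  rewrite big_ord0 /= integral_dirac//.
    by rewrite diracT mul1e big_ord0.
  apply: (eq_measurable_fun (cst 1%E)) => //.
  by move=> x _; rewrite big_ord0.
have mprod p (g : 'I_p -> measurableTypeR R -> R) :
    (forall i, measurable_fun [set: measurableTypeR R] (g i)) ->
    measurable_fun [set: Rn R p] (fun x => (\prod_(i < p) g i (tnth x i))%:E).
  move=> mg; apply/measurable_EFinP; apply: measurable_prod => i _.
  by apply: (measurableT_comp (mg i)); exact: measurable_tnth.
have prod_ge0 p (g : 'I_p -> measurableTypeR R -> R) (x : Rn R p) :
    (forall i y, 0 <= g i y) -> (0 <= (\prod_(i < p) g i (tnth x i))%:E)%E.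
  by move=> g_ge0; rewrite lee_fin prodr_ge0.
rewrite big_ord_recl /= /lebesgue_cons ge0_integral_pushforward//=; last 3 first.
- exact: measurable_tuple_cons.
- exact: mprod.
- by move=> x _; exact: prod_ge0.
rewrite preimage_setT fubini_tonelli1/=; last 2 first.
- apply: (measurableT_comp (mprod _ _ mf)); exact: measurable_tuple_cons.
- by move=> x; exact: prod_ge0.
rewrite -(IH (fun i => f (lift ord0 i)))//.
have fE (x : measurableTypeR R) (t : Rn R n) :
    (\prod_(i < n.+1) f i (tnth (tuple_cons (x, t)) i))%:E =
    ((f ord0 x)%:E * (\prod_(i < n) f (lift ord0 i) (tnth t i))%:E)%E.
  rewrite big_ord_recl tnth0 EFinM; congr (_ * (_)%:E)%E.
  by apply: eq_bigr => i _; rewrite tnthS.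
under eq_integral => x _.
  rewrite /fubini_F; under eq_integral do rewrite fE.
  rewrite ge0_integralZl//; last 3 first.
  - exact: (mprod _ (fun i => f (lift ord0 i))).
  - by move=> t _; exact: (prod_ge0 _ (fun i => f (lift ord0 i))).
  - by rewrite lee_fin.
  over.
rewrite ge0_integralZr//.
- exact/measurable_EFinP.
- by move=> x _; rewrite lee_fin.
- by apply: integral_ge0 => t _; exact: (prod_ge0 _ (fun i => f (lift ord0 i))).
Qed.

End gaussian_integral.

Lemma powR_expR_ln {R : realType} (x y : R) : 0 < x -> x `^ y = expR (y * ln x).
Proof. by move=> x_gt0; rewrite /powR gt_eqF. Qed.

(** * Measurability and Gaussian domination of normal densities *)

Section normal_density.
Context {R : realType}.

Lemma measurable_quadratic_form d (T : measurableType d) n (S : 'M[R]_n)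
    (f : T -> 'rV[R]_n) :
  (forall i, measurable_fun [set: T] (fun t => f t 0 i)) ->
  measurable_fun [set: T] (fun t => (f t *m S *m (f t)^T) 0 0).
Proof.
move=> mf; under eq_fun do rewrite mxE.
apply: measurable_sum => j; under eq_fun do rewrite !mxE.
apply: measurable_funM => //; apply: measurable_sum => i.
by apply: measurable_funM.
Qed.

Lemma measurable_normal_density n (g : param R n -> R) :
  is_normal_density g -> measurable_fun [set: param R n] g.
Proof.
move=> [mu [S [_ gE]]]; have -> := funext gE.
apply: measurable_funM => //; apply: measurableT_comp => //.
apply: measurable_funM => //; apply: measurableT_comp => //.
apply: measurable_quadratic_form => i.
under eq_fun do rewrite !mxE; apply: measurable_funB => //.
(* The first [n] coordinates come from psi, the last one is nu. *)
have [j _|j _] := fintype.splitP i.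
  under eq_fun do rewrite mxE.
  apply: (measurableT_comp (f := (fun x : Rn R n => tnth x j))) => //.
  exact: measurable_tnth.
under eq_fun do rewrite !mxE ord1 eqxx mulr1n.
exact: measurable_snd.
Qed.

Lemma normal_density_ge0 n (g : param R n -> R) t :
  is_normal_density g -> 0 <= g t.
Proof.
by move=> [mu [S [_ ->]]]; rewrite mulr_ge0 ?expR_ge0 ?invr_ge0 ?sqrtr_ge0.
Qed.

(** The lower bound for the form of the inverse covariance decouples the coordinates: all get the
    same rate [k], and [u], [v] are the components of the mean. *)
Lemma normal_density_le n (g : param R n -> R) : is_normal_density g ->
  exists (C k v : R) (u : 'I_n -> R), [/\ 0 <= C, 0 < k &
    forall t, g t <= C * expR (- \sum_i k * ((tnth t.1 i : R) - u i) ^+ 2 -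
                               k * ((t.2 : R) - v) ^+ 2)].
Proof.
move=> [mu [S [Spos gE]]]; have [k k_gt0 kS] := posdefmx_invmx_ge _ Spos.
exists (Num.sqrt ((2 * pi) ^+ (n + 1) * \det S))^-1, (k / 2),
  (mu 0 (rshift n 0)), (fun i => mu 0 (lshift 1 i)).
split=> [| |t]; [by rewrite invr_ge0 sqrtr_ge0|by rewrite divr_gt0|].
rewrite gE ler_wpM2l ?invr_ge0 ?sqrtr_ge0// ler_expR.
have := kS (row_of_param t - mu).
rewrite sqnormE big_split_ord big_ord1 /=.
under eq_bigr do rewrite mxE row_mxEl !mxE.
rewrite mxE row_mxEr !mxE eqxx mulr1n -mulr_sumr; lra.
Qed.

End normal_density.

(** * The COMM weights, their sum G, and finiteness of K^-1 *)

Section COMM_family.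
Context {R : realType} {r m : nat}.
Implicit Types (j k : r.-tuple nat) (t : param R r.-1).

(** Provides a summand bounding G from below; the witness puts all of [m] on the first
    coordinate. *)
Lemma commD_nonempty : (0 < r)%N -> exists j, commD m j.
Proof.
move=> r_gt0; pose i0 := Ordinal r_gt0.
exists [tuple if i == i0 then m else 0%N | i < r].
rewrite /commD /= (bigD1 i0)//= tnth_mktuple eqxx big1 ?addn0// => i ii0.
by rewrite tnth_mktuple (negbTE ii0).
Qed.

Lemma factprod_gt0 j : 0 < factprod (R := R) j.
Proof. by rewrite ltr0n prodn_gt0// => i; rewrite fact_gt0. Qed.

Lemma dotD (psi : Rn R r.-1) a1 a2 : dot psi (a1 + a2) = dot psi a1 + dot psi a2.
Proof.
by rewrite -big_split; apply: eq_bigr => i _; rewrite mxE mulrDr.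
Qed.

Lemma measurable_dot (a : 'rV[R]_r.-1) :
  measurable_fun [set: param R r.-1] (fun t => dot t.1 a).
Proof.
apply: measurable_sum => i; apply: measurable_funM => //.
apply: (measurableT_comp (f := (fun x : Rn R r.-1 => tnth x i))) => //.
exact: measurable_tnth.
Qed.

(** The weight is the exponential of a linear form in (psi, nu); both the domination of G^-c and the
    conjugacy rest on this. *)
Lemma comm_weightE t j :
  comm_weight t j = expR (dot t.1 (star j) - ln (factprod j) * t.2).
Proof.
by rewrite /comm_weight powR_expR_ln ?factprod_gt0// expRD expRN (mulrC t.2).
Qed.

Lemma comm_weight_gt0 t j : 0 < comm_weight t j.
Proof. by rewrite comm_weightE expR_gt0. Qed.

Lemma measurable_comm_weight j :
  measurable_fun [set: param R r.-1] (fun t => comm_weight t j).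
Proof.
under eq_fun do rewrite comm_weightE.
apply: measurableT_comp => //; apply: measurable_funB; first exact: measurable_dot.
by apply: measurable_funM => //; exact: measurable_snd.
Qed.

Lemma commGE t :
  commG m t = \sum_(j <- fset_set (commD m)) comm_weight t j.
Proof. by rewrite /commG fsbig_finite//; exact: finite_commD. Qed.

Lemma measurable_commG : measurable_fun [set: param R r.-1] (commG m).
Proof.
rewrite (_ : commG m = fun t => \sum_(j <- fset_set (commD m)) comm_weight t j).
  by apply: measurable_sum => j; exact: measurable_comm_weight.
by apply/funext => t; rewrite commGE.
Qed.

Lemma comm_weight_le_commG t j : commD m j -> comm_weight t j <= commG m t.
Proof.
move=> Dj; rewrite commGE (big_fsetD1 j)/=.
  by rewrite lerDl sumr_ge0// => i _; rewrite ltW// comm_weight_gt0.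
by rewrite in_fset_set; [exact/mem_set|exact: finite_commD].
Qed.

Lemma commG_gt0 t : (0 < r)%N -> 0 < commG m t.
Proof.
move=> /commD_nonempty[j Dj].
exact: lt_le_trans (comm_weight_gt0 t j) (comm_weight_le_commG _ _ Dj).
Qed.

(** Since -c <= 0, taking this power reverses the bound of G below by the weight of [j], whose
    logarithm is linear in (psi, nu). *)
Lemma commG_powRN_le t j (c : R) : commD m j -> 0 <= c ->
  commG m t `^ (- c) <= expR (c * ln (factprod j) * t.2 - dot t.1 (c *: star j)).
Proof.
move=> Dj c_ge0; have Gge := comm_weight_le_commG t _ Dj.
have w_gt0 := comm_weight_gt0 t j; have G_gt0 := lt_le_trans w_gt0 Gge.
rewrite powR_expR_ln// ler_expR (@le_trans _ _ (- c * ln (comm_weight t j)))//.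
  by rewrite ler_wnM2l ?oppr_le0// ler_ln.
have -> : dot t.1 (c *: star j) = c * dot t.1 (star j).
  by rewrite mulr_sumr; apply: eq_bigr => i _; rewrite mxE mulrCA.
rewrite comm_weightE expRK; lra.
Qed.

Section family.
Variables (g : param R r.-1 -> R) (a : 'rV[R]_r.-1) (b c : R).
Hypotheses (r_gt0 : (0 < r)%N) (hg : is_normal_density g).

Lemma measurable_kernel_fun :
  measurable_fun [set: param R r.-1] (kernel_fun m g a b c).
Proof.
apply: measurable_funM; first apply: measurable_funM.
- exact: measurable_normal_density.
- apply: measurableT_comp => //; apply: measurable_funB.
    exact: measurable_dot.
  by apply: measurable_funM => //; exact: measurable_snd.
- exact: measurableT_comp (measurable_powR _) measurable_commG.
Qed.

Lemma kernel_fun_ge0 t : 0 <= kernel_fun m g a b c t.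
Proof.
by rewrite !mulr_ge0 ?powR_ge0 ?expR_ge0// normal_density_ge0.
Qed.

(** Tonelli turns the iterated integral into one over the product measure, to which the densities
    refer. *)
Lemma KinvE :
  Kinv m g a b c = (\int[lebesgue_param r.-1]_t (kernel_fun m g a b c t)%:E)%E.
Proof.
rewrite /lebesgue_param fubini_tonelli1//.
  by apply/measurable_EFinP; exact: measurable_kernel_fun.
by move=> t; rewrite lee_fin kernel_fun_ge0.
Qed.

Lemma Kinv_ge0 : (0 <= Kinv m g a b c)%E.
Proof.
by rewrite KinvE integral_ge0// => t _; rewrite lee_fin kernel_fun_ge0.
Qed.

Lemma Kinv_lty : 0 <= c -> (Kinv m g a b c < +oo)%E.
Proof.
move=> c_ge0; have [j Dj] := commD_nonempty r_gt0.
have [C [k [v [u [C_ge0 k_gt0 g_le]]]]] := normal_density_le _ _ hg.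
(* [l] and the slope in [h] collect the linear terms: [a] and [- b] from the kernel, the multiples
   of [c] from the bound on G^-c. *)
pose l := a - c *: star j.
pose f i (x : measurableTypeR R) := expR (l 0 i * x - k * ((x : R) - u i) ^+ 2).
pose h (y : measurableTypeR R) :=
  expR ((c * ln (factprod j) - b) * y - k * ((y : R) - v) ^+ 2).
have mquad (p q s : R) : measurable_fun [set: measurableTypeR R]
    (fun x : measurableTypeR R => expR (p * x - q * ((x : R) - s) ^+ 2)).
  apply: measurableT_comp => //; apply: measurable_funB.
    exact: measurable_funM.
  apply: measurable_funM => //; apply: measurable_funX; exact: measurable_funB.
have kernel_le t : kernel_fun m g a b c t <= C * (\prod_i f i (tnth t.1 i) * h t.2).
  rewrite /kernel_fun -mulrA.
  apply: le_trans (ler_pM _ _ (g_le t)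
    (ler_wpM2l _ (commG_powRN_le t _ _ Dj c_ge0))) _.
  - exact: normal_density_ge0.
  - by rewrite mulr_ge0 ?expR_ge0 ?powR_ge0.
  - exact: expR_ge0.
  rewrite -[leLHS]mulrA ler_wpM2l// -expR_sum -!expRD ler_expR.
  rewrite big_split/= sumrN.
  have -> : \sum_i l 0 i * tnth t.1 i = dot t.1 a - dot t.1 (c *: star j).
    rewrite -sumrB; apply: eq_bigr => i _.
    by rewrite /l !mxE; ring.
  lra.
have mprod : measurable_fun [set: Rn R r.-1] (fun x => \prod_i f i (tnth x i)).
  apply: measurable_prod => i _; apply: (measurableT_comp (mquad _ _ _)).
  exact: measurable_tnth.
have prod_ge0 (x : Rn R r.-1) : 0 <= \prod_i f i (tnth x i).
  by rewrite prodr_ge0// => i _; exact: expR_ge0.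
have Ih_lty : (\int[lebesgue_measure]_y (h y)%:E < +oo)%E.
  exact: integral_expR_quadratic_lty.
have Ih_ge0 : (0 <= \int[lebesgue_measure]_y (h y)%:E)%E.
  by apply: integral_ge0 => y _; rewrite lee_fin expR_ge0.
have Ih_fin : (\int[lebesgue_measure]_y (h y)%:E)%E \is a fin_num.
  by rewrite ge0_fin_numE.
(* Integrating over nu first leaves the factor [D], constant in psi. *)
pose D := C * fine (\int[lebesgue_measure]_y (h y)%:E)%E.
have D_ge0 : 0 <= D by rewrite mulr_ge0// fine_ge0.
apply: (@le_lt_trans _ _ (\int[lebesgue_Rn r.-1]_x
    (D%:E * (\prod_i f i (tnth x i))%:E))%E).
  rewrite KinvE /lebesgue_param.
  have mbound : measurable_fun [set: param R r.-1]
      (fun t => (C * (\prod_i f i (tnth t.1 i) * h t.2))%:E).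
    apply/measurable_EFinP/measurable_funM => //; apply: measurable_funM.
      exact: (measurableT_comp mprod measurable_fst).
    exact: (measurableT_comp (mquad _ _ _) measurable_snd).
  have bound_ge0 t : (0 <= (C * (\prod_i f i (tnth t.1 i) * h t.2))%:E)%E.
    by rewrite lee_fin !mulr_ge0// expR_ge0.
  apply: (@le_trans _ _ (\int[lebesgue_Rn r.-1 \x lebesgue_measure]_t
      (C * (\prod_i f i (tnth t.1 i) * h t.2))%:E)%E).
    apply: ge0_le_integral => //.
    - by move=> t _; rewrite lee_fin kernel_fun_ge0.
    - by apply/measurable_EFinP; exact: measurable_kernel_fun.
    - by move=> t _; rewrite lee_fin.
  rewrite fubini_tonelli1// le_eqVlt; apply/orP; left; apply/eqP.
  apply: eq_integral => x _; rewrite /fubini_F /D EFinM fineK//.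
  under eq_integral do rewrite /= mulrA EFinM.
  rewrite ge0_integralZl//=.
  - by rewrite EFinM muleAC.
  - by apply/measurable_EFinP; exact: mquad.
  - by move=> y _; rewrite lee_fin expR_ge0.
  - by rewrite lee_fin mulr_ge0.
rewrite ge0_integralZl//.
(* What remains is a finite product of one-dimensional Gaussian integrals. *)
- rewrite integral_lebesgue_Rn_prod//; last 2 first.
  - by move=> i; exact: mquad.
  - by move=> i x; exact: expR_ge0.
  have f_fin i : (\int[lebesgue_measure]_x (f i x)%:E)%E \is a fin_num.
    rewrite ge0_fin_numE; first exact: integral_expR_quadratic_lty.
    by apply: integral_ge0 => y _; rewrite lee_fin expR_ge0.
  rewrite ltey_eq fin_numM//.
  by apply: (big_ind (fun x => x \is a fin_num)) => // x y; exact: fin_numM.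
- exact/measurable_EFinP.
- by move=> x _; rewrite lee_fin.
Qed.

End family.

End COMM_family.

(** * Integration against a measure given by a density *)

Section density.
Context d (T : measurableType d) (R : realType).
Import HBNNSimple.

(** Indicators satisfy this by the definition of a density; linearity extends it to simple
    functions, monotone convergence to nonnegative measurable ones. *)
Lemma ge0_integral_is_density (lambda P : {measure set T -> \bar R}) (f : T -> R)
    (h : T -> \bar R) (A : set T) :
  is_density lambda P f -> measurable_fun [set: T] h -> (forall x, (0 <= h x)%E) ->
  measurable A ->
  (\int[P]_(x in A) h x = \int[lambda]_(x in A) (h x * (f x)%:E))%E.
Proof.
move=> [mf f_ge0 fP] mh h_ge0 mA.
pose s := nnsfun_approx measurableT mh.
have s_h x : ((s n x)%:E @[n --> \oo] --> h x)%E.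
  by apply: cvg_nnsfun_approx => // y _; exact: h_ge0.
have nd_s x : {homo (fun n => s n x) : n k / (n <= k)%N >-> n <= k}.
  by move=> n k nk; exact/lefP/nd_nnsfun_approx.
have -> : (\int[P]_(x in A) h x =
    lim (\int[P]_(x in A) (s n x)%:E @[n --> \oo]))%E.
  rewrite -monotone_convergence//.
  - by apply: eq_integral => x _; apply/esym/cvg_lim => //; exact: s_h.
  - by move=> n; apply/measurable_EFinP/measurable_funTS.
  - by move=> n x _; rewrite lee_fin.
  - by move=> x _ n k nk; rewrite lee_fin nd_s.
have -> : (\int[lambda]_(x in A) (h x * (f x)%:E) =
    lim (\int[lambda]_(x in A) ((s n x)%:E * (f x)%:E) @[n --> \oo]))%E.
  rewrite -monotone_convergence//.
  - apply: eq_integral => x _; apply/esym/cvg_lim => //.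
    by apply: cvgeZr => //; exact: s_h.
  - move=> n; apply/measurable_funTS/emeasurable_funM; exact/measurable_EFinP.
  - by move=> n x _; rewrite mule_ge0 ?lee_fin ?f_ge0.
  - by move=> x _ n k nk; rewrite lee_wpmul2r ?lee_fin ?f_ge0 ?nd_s.
(* Both sides are limits along the same simple functions, so it suffices to treat each [s n]. *)
congr (lim (_ @ \oo)); apply/funext => n.
have sE x : (s n x)%:E = (\sum_(y \in range (s n))
    (y * \1_(s n @^-1` [set y]) x)%:E)%E by rewrite fimfunE -fsumEFin.
under eq_integral do rewrite sE.
have ms y : measurable_fun A (fun x => (y * \1_(s n @^-1` [set y]) x)%:E).
  by apply/measurable_funTS/measurable_EFinP/measurable_funM.
have term_ge0 y x : (0 <= (y * \1_(s n @^-1` [set y]) x)%:E)%E.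
  exact: nnfun_muleindic_ge0.
rewrite ge0_integral_fsum//.
under [RHS]eq_integral => x _ do rewrite sE ge0_mule_fsuml//.
rewrite ge0_integral_fsum//; last 2 first.
- by move=> y; apply: emeasurable_funM => //; exact/measurable_funTS/measurable_EFinP.
- by move=> y x _; rewrite mule_ge0 ?term_ge0 ?lee_fin ?f_ge0.
apply: eq_fsbigr => y /set_mem[z _ szy].
have y_ge0 : 0 <= y by rewrite -szy.
under eq_integral do rewrite EFinM.
under [RHS]eq_integral do rewrite EFinM -muleA.
rewrite !ge0_integralZl//.
(* For a single level set, this is [fP] applied to its intersection with [A]. *)
- congr (_ * _)%E; rewrite integral_indic// setIC fP; last exact: measurableI.
  rewrite integral_mkcondr; apply: eq_integral => x _.
  by rewrite epatch_indic muleC.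
- apply: emeasurable_funM; first exact/measurable_EFinP.
  exact/measurable_funTS/measurable_EFinP.
- by move=> x _; rewrite mule_ge0 ?lee_fin ?f_ge0.
- exact/measurable_EFinP.
Qed.

(** A vanishing integral makes [f] zero almost everywhere; as [f] is nowhere zero, the whole space
    would be negligible. *)
Lemma integral_gt0 (mu : {measure set T -> \bar R}) (f : T -> R) :
  measurable_fun [set: T] f -> (forall x, 0 < f x) -> (0 < mu [set: T])%E ->
  (0 < \int[mu]_x (f x)%:E)%E.
Proof.
move=> mf f_gt0 muT; rewrite lt0e integral_ge0 ?andbT; last first.
  by move=> x _; rewrite lee_fin ltW.
apply: contraTN muT => /eqP If0; rewrite -leNgt le_eqVlt; apply/orP; left.
have : (\int[mu]_x `|(f x)%:E| = 0)%E.
  by rewrite -[RHS]If0; apply: eq_integral => x _; rewrite gee0_abs// lee_fin ltW.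
move/ae_eq_integral_abs => /(_ measurableT).
have mEf : measurable_fun [set: T] (fun x => (f x)%:E) by exact/measurable_EFinP.
move=> /(_ mEf) [N [mN muN0 sub]].
rewrite -muN0; apply/eqP; congr (mu _); apply/seteqP; split=> // x _.
apply: sub => /= /(_ Logic.I) [fx0].
by have := f_gt0 x; rewrite fx0 ltxx.
Qed.

End density.

(** * Bayes' formula for the kernels *)

Section posterior.
Context {R : realType} {r m : nat}.
Variables (g : param R r.-1 -> R) (a : 'rV[R]_r.-1) (b c : R).
Hypotheses (r_gt0 : (0 < r)%N) (hg : is_normal_density g).
Implicit Types (k : r.-tuple nat) (t : param R r.-1).

Lemma comm_pmf_gt0 t k : commD m k -> 0 < comm_pmf m t k.
Proof.
by move=> Dk; rewrite /comm_pmf mem_set// divr_gt0 ?comm_weight_gt0 ?commG_gt0.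
Qed.

Lemma measurable_comm_pmf k : commD m k ->
  measurable_fun [set: param R r.-1] (fun t => comm_pmf m t k).
Proof.
move=> Dk; rewrite /comm_pmf mem_set//.
apply: measurable_funM; first exact: measurable_comm_weight.
(* The inverse is written as the power -1 to use the measurability of powers. *)
rewrite (_ : (fun t => _) = (fun t => commG m t `^ (-1))).
  exact: measurableT_comp (measurable_powR _) measurable_commG.
by apply/funext => t; rewrite powR_inv1// ltW// commG_gt0.
Qed.

(** The weight of [k] shifts [a] by [star k] and [b] by [ln (factprod k)] in the exponent, and
    dividing by G lowers its power by 1. *)
Lemma comm_pmf_kernel_fun t k : commD m k ->
  comm_pmf m t k * kernel_fun m g a b c t =
  kernel_fun m g (a + star k) (b + ln (factprod k)) (c + 1) t.
Proof.
move=> Dk; have G_gt0 := commG_gt0 (m := m) t r_gt0.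
rewrite /comm_pmf mem_set// comm_weightE /kernel_fun dotD.
have -> : - (c + 1) = - c + - 1 :> R by rewrite opprD.
rewrite (@powRD _ (commG m t)); last by rewrite (gt_eqF G_gt0) implybT.
rewrite (powR_inv1 (ltW G_gt0)).
have -> : dot t.1 a + dot t.1 (star k) - (b + ln (factprod k)) * t.2 =
    (dot t.1 a - b * t.2) + (dot t.1 (star k) - ln (factprod k) * t.2) by ring.
rewrite (expRD (dot t.1 a - _)); ring.
Qed.

Lemma measurable_hstar : measurable_fun [set: param R r.-1] (hstar m g a b c).
Proof. by apply: measurable_funM => //; exact: measurable_kernel_fun. Qed.

Lemma hstar_ge0 t : 0 <= hstar m g a b c t.
Proof.
rewrite mulr_ge0 ?kernel_fun_ge0// invr_ge0 fine_ge0//; exact: Kinv_ge0.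
Qed.

Lemma integral_hstar (A : set (param R r.-1)) : measurable A ->
  (\int[lebesgue_param r.-1]_(t in A) (hstar m g a b c t)%:E =
   (fine (Kinv m g a b c))^-1%:E *
     \int[lebesgue_param r.-1]_(t in A) (kernel_fun m g a b c t)%:E)%E.
Proof.
move=> mA; under eq_integral do rewrite /hstar mulrC EFinM.
rewrite ge0_integralZl//.
- by apply/measurable_funTS/measurable_EFinP; exact: measurable_kernel_fun.
- by move=> t _; rewrite lee_fin kernel_fun_ge0.
- by rewrite lee_fin invr_ge0 fine_ge0//; exact: Kinv_ge0.
Qed.

End posterior.

(** * Finiteness of K^-1 and the posterior density *)

Theorem mainTheorem6 (R : realType) (r m : nat) (hr : (2 <= r)%N) (hm : (1 <= m)%N)
    (g : param R r.-1 -> R) (hg : is_normal_density g)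
    (a : 'rV[R]_r.-1) (b c : R) (hb : 0 < b) (hc : 0 < c) :
  (Kinv m g a b c < +oo)%E /\
  forall (d : measure_display) (Omega : measurableType d) (P : probability Omega R)
    (Theta : {RV P >-> param R r.-1}) (Y : {RV P >-> r.-tuple nat}),
    is_density (lebesgue_param r.-1) (distribution P Theta) (hstar m g a b c) ->
    has_conditional_pmf Theta Y (comm_pmf m) ->
    forall k : r.-tuple nat, commD m k ->
      is_posterior_density Theta Y (lebesgue_param r.-1) k
        (hstar m g (a + star k) (b + ln (factprod k)) (c + 1)).
Proof.
have r_gt0 : (0 < r)%N by exact: ltnW.
split=> [|d Omega P Theta Y hTheta hY k Dk]; first exact/Kinv_lty/ltW.
set a' := a + star k; set b' := b + ln (factprod k); set c' := c + 1.
(* [K] is the reciprocal of the constant K(a, b, c) of the family. *)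
pose K := fine (Kinv m g a b c).
(* If [K] were 0, its inverse would be 0 by convention, and the prior would have total mass 0
   instead of 1. *)
have K_gt0 : 0 < K.
  rewrite lt0r fine_ge0 ?Kinv_ge0// andbT; apply/eqP => K0.
  have [_ _ /(_ setT measurableT)] := hTheta.
  rewrite probability_setT integral_hstar// -/K K0 invr0 mul0e => /eqP.
  by rewrite onee_eq0.
have pmf_ge0 t : 0 <= comm_pmf m t k by rewrite ltW// comm_pmf_gt0.
have mpmf := measurable_comm_pmf (R := R) r_gt0 k Dk.
have mK' := measurable_kernel_fun (m := m) g a' b' c' hg.
(* The prior integral of the mass function at [k], whose integrand is the updated kernel divided by
   [K]. *)
have jointE A : measurable A -> P (Theta @^-1` A `&` Y @^-1` [set k]) =
    (K^-1%:E * \int[lebesgue_param r.-1]_(t in A) (kernel_fun m g a' b' c' t)%:E)%E.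
  move=> mA; rewrite hY// (ge0_integral_is_density _ _ _ _ _ _ _ _ hTheta)//.
  - rewrite -ge0_integralZl//.
    + apply: eq_integral => t _; rewrite -!EFinM -comm_pmf_kernel_fun//.
      by rewrite /hstar -/K; congr (_)%:E; ring.
    + exact/measurable_funTS/measurable_EFinP.
    + by move=> t _; rewrite lee_fin kernel_fun_ge0.
    + by rewrite lee_fin invr_ge0 ltW.
  - exact/measurable_EFinP.
  - by move=> t; rewrite lee_fin pmf_ge0.
(* The whole space in place of [A] yields the marginal probability of [k]. *)
have PYE : P (Y @^-1` [set k]) = (K^-1%:E * Kinv m g a' b' c')%E.
  by rewrite KinvE// -jointE// preimage_setT setTI.
(* A strictly positive mass function is integrated against a probability measure. *)
have PY_gt0 : (0 < P (Y @^-1` [set k]))%E.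
  rewrite -[Y @^-1` _]setTI -(preimage_setT Theta) hY//.
  apply: integral_gt0 => // [t|]; first exact: comm_pmf_gt0.
  by rewrite [X in (_ < X)%E](probability_setT (distribution P Theta)) lte01.
split; first exact: PY_gt0.
split.
- exact: measurable_hstar.
- by move=> t; exact: hstar_ge0.
move=> A mA; rewrite /conditional_law PYE jointE; last exact: mA.
rewrite integral_hstar; [|exact: hg|exact: mA].
(* [conditional_law] is a quotient of [fine] values; finiteness of both integrals lets [fine]
   commute with the products. *)
have K'_fin : Kinv m g a' b' c' \is a fin_num.
  rewrite ge0_fin_numE ?Kinv_ge0//; apply: Kinv_lty => //.
  by rewrite addr_ge0// ltW.
have I_fin : (\int[lebesgue_param r.-1]_(t in A) (kernel_fun m g a' b' c' t)%:E)%E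
    \is a fin_num.
  rewrite ge0_fin_numE; last first.
    by apply: integral_ge0 => t _; rewrite lee_fin kernel_fun_ge0.
  move: K'_fin; rewrite ge0_fin_numE ?Kinv_ge0//; apply: le_lt_trans.
  rewrite KinvE//; apply: ge0_subset_integral => //.
  - exact/measurable_EFinP.
  - by move=> t _; rewrite lee_fin kernel_fun_ge0.
(* The new normalising integral is [K] times the marginal probability of [k], hence nonzero. *)
have K'_neq0 : fine (Kinv m g a' b' c') != 0.
  move: PY_gt0; rewrite PYE -(fineK K'_fin) -EFinM lte_fin.
  by rewrite pmulr_rgt0 ?invr_gt0// => /lt0r_neq0.
rewrite -(fineK I_fin) [fine (_ * Kinv _ _ _ _ _)]fineM//.
rewrite fineM// -EFinM; congr (_)%:E.
(* The factor [K^-1] common to joint and marginal cancels, leaving the new kernel over its own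
   integral. *)
by field; rewrite K'_neq0 /= invr_eq0 gt_eqF.
Qed.
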